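(* Let $\mathcal{N}$ be a set with $n\in\mathbb{N}$ distinct elements and let $k\in\{1,\ldots,n\}$. Then \[ |C(\mathcal{N},k)|=\sum_{\ell=1}^{\min\{2^k-2,\,n\}}\ell!\,\tilde{s}(n,\ell)\, |F(k,\ell)|. \]
   Context: $\mathbb{N}=\{1,2,\ldots\}$. Constructive covers. A finite sequence $\mathscr{A}=(A_1,\ldots,A_k)$ of distinct subsets of $\mathcal{N}$ is a constructive ordered $k$-cover of $\mathcal{N}$ if (i) $\bigcup_{i=1}^k A_i=\mathcal{N}$ and (ii) $A_i\setminus A_j\neq\emptyset$ for every $i,j\in\{1,\ldots,k\}$ with $i\neq j$. $C(\mathcal{N},k)$ is the set of all constructive ordered $k$-covers of $\mathcal{N}$. Integrated Stirling numbers. For $n,\ell\in\mathbb{N}$, $\tilde{s}(n,\ell)=\frac{1}{\ell!}\sum_{j=0}^\ell (-1)^{\ell-j}\binom{\ell}{j}(j+1)^n$. Labelings. Let $e,c$ be two distinct symbols and $\mathbb{T}(k)=\{e,c\}^k\setminus\{(e,\ldots,e),(c,\ldots,c)\}$. $G(k)$ is the set of all $(x_t)_{t\in\mathbb{T}(k)}$ with $x_t\in\{0,1\}$ for all $t\in\mathbb{T}(k)$ and $\sum_{t\in\mathbb{T}(k)\colon t_i=c,\,t_j=e}x_t\geq 1$ for all $i,j\in\{1,\ldots,k\}$ with $i\neq j$. For $\ell\in\{1,\ldots,2^k-2\}$, $F(k,\ell)=\{(x_t)_{t\in\mathbb{T}(k)}\in G(k)\mid \sum_{t\in\mathbb{T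}(k)}x_t=\ell\}$.
   Formalization: The case k = 1 is excluded, so k ranges over {2,…,n}: for k = 1 the only constructive ordered cover is (𝒩), so the left side is 1, while the sum over ℓ from 1 to min{0,n} = 0 is empty and equals 0. *)

(* Defs.v *)
From mathcomp Require Import all_boot all_order all_algebra.

Set Implicit Arguments.
Unset Strict Implicit.
Unset Printing Implicit Defensive.

Definition constructive_cover (N : finType) (k : nat) (A : k.-tuple {set N}) :=
  [&& uniq A,
      \bigcup_(i < k) tnth A i == [set: N] &
      [forall i : 'I_k, forall j : 'I_k,
         (i != j) ==> (tnth A i :\: tnth A j != set0)]].

Definition constructive_covers (N : finType) (k : nat) :
    {set k.-tuple {set N}} :=
  [set A | constructive_cover A].

Definition istirling (n l : nat) : rat :=
  ((l`!)%:R^-1 *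
     \sum_(j < l.+1) (-1) ^+ (l - j) * ('C(l, j))%:R * (j.+1)%:R ^+ n)%R.

(* The two distinct symbols e and c are encoded as booleans. *)
Definition sym_e : bool := false.
Definition sym_c : bool := true.

Definition mixed (k : nat) (t : k.-tuple bool) : bool :=
  (t != [tuple of nseq k sym_e]) && (t != [tuple of nseq k sym_c]).

Definition labels (k : nat) := {t : k.-tuple bool | mixed t}.

(* The values x_t in {0, 1} are booleans, coerced to nat in the sums. *)
Definition labelings (k : nat) : {set {ffun labels k -> bool}} :=
  [set x : {ffun labels k -> bool} |
     [forall i : 'I_k, forall j : 'I_k, (i != j) ==>
        (1 <= \sum_(t : labels k | (tnth (val t) i == sym_c) &&
                                   (tnth (val t) j == sym_e)) x t)]].

Definition labelings_of_weight (k l : nat) : {set {ffun labels k -> bool}} :=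
  [set x in labelings k | \sum_(t : labels k) x t == l].

(* Main.v *)
Require Import Defs.
From mathcomp Require Import all_boot all_order all_algebra.

(* A cover is recorded by the map sending each point a to the tuple of truth
   values of a \in A_i. This tuple is never (e, ..., e), so it is either a mixed
   label or (c, ..., c), the latter encoded as None. Condition (ii) only
   depends on the set S of labels that are attained, and says that its
   indicator lies in G(k). By inclusion-exclusion the number of maps from N to
   option (labels k) attaining exactly S is l! s~(n, l), where l = #|S|; the
   result follows by grouping the maps according to l. *)

Set Implicit Arguments.
Unset Strict Implicit.
Unset Printing Implicit Defensive.

Import GRing.Theory Num.Theory.

Section AttainedValues.

Variables (N T : finType).

Definition attained (g : {ffun N -> option T}) : {set T} :=
  [set t | Some t \in codom g].

Lemma card_attained_le (g : {ffun N -> option T}) : #|attained g| <= #|N|.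
Proof.
rewrite -(card_imset _ (@Some_inj _)).
apply: leq_trans (leq_image_card g predT); apply/subset_leq_card/subsetP => y.
by case/imsetP => t; rewrite inE => gt ->.
Qed.

(** Each point may take [None] or a label of [S]; the extra value [None] is the source of the shift
    in [(j+1)^n] in the integrated Stirling numbers. *)
Lemma card_attained_sub (S : {set T}) :
  #|[set g | attained g \subset S]| = #|S|.+1 ^ #|N|.
Proof.
have -> : #|S|.+1 = #|None |: (Some @: S)|.
  rewrite cardsU1 card_imset; last exact: Some_inj.
  by have -> : None \notin [set Some t | t in S] by apply/imsetP; case.
rewrite -card_ffun_on; apply: eq_card => g; rewrite inE; apply/subsetP/ffun_onP.
- move=> gS a; rewrite !inE; case ga: (g a) => [t|] //=; apply: imset_f.
  by apply: gS; rewrite inE -ga codom_f.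
move=> gS t; rewrite inE => /codomP [a ga]; move: (gS a).
by rewrite -ga !inE /= mem_imset //; exact: Some_inj.
Qed.

Local Open Scope ring_scope.

Lemma sum_subset_card (R : nmodType) (S : {set T}) (f : nat -> R) :
  \sum_(A : {set T} | A \subset S) f #|A| =
    \sum_(j < #|S|.+1) f j *+ 'C(#|S|, j).
Proof.
have leS (A : {set T}) : A \subset S -> (#|A| < #|S|.+1)%N.
  by move/subset_leq_card.
rewrite (partition_big (fun A : {set T} => inord #|A| : 'I_#|S|.+1) predT) //=.
apply: eq_bigr => j _; rewrite -['C(_, _)]cards_draws -sumr_const.
rewrite (eq_bigl
  (fun A : {set T} => A \in [set A : {set T} | (A \subset S) && (#|A| == j)])).
  by apply: eq_bigr => A; rewrite inE => /andP [_ /eqP ->].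
move=> A; rewrite inE; case: (boolP (A \subset S)) => //= AS.
by rewrite -val_eqE /= inordK // leS.
Qed.

(** Writing [B = S :\: Q] turns the interval into the subsets [Q] of [S :\: A], with sign
    [(-1)^#|Q|]; the binomial theorem then gives [(1 - 1)^#|S :\: A|], where [0^0 = 1] accounts for
    [A = S]. *)
Lemma sum_sign_interval (A S : {set T}) :
  \sum_(B : {set T} | (A \subset B) && (B \subset S)) (-1) ^+ (#|S| - #|B|)
    = (A == S)%:R :> rat.
Proof.
case: (boolP (A \subset S)) => AS; last first.
  rewrite big_pred0 => [|B].
    by case: eqP AS => // ->; rewrite subxx.
  by apply/negP => /andP [AB /(subset_trans AB)]; apply/negP.
rewrite (reindex_onto (fun Q => S :\: Q) (fun B => S :\: B)) /=; last first.
  by move=> B /andP [_ BS]; rewrite setDDr setDv set0U; apply/setIidPr.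
rewrite (eq_big (fun Q : {set T} => Q \subset S :\: A)
                (fun Q : {set T} => (-1) ^+ #|Q|)); first last.
- move=> Q /andP [_ /eqP QE]; have QS : Q \subset S by rewrite -QE subsetDl.
  by rewrite cardsD (setIidPr QS) subKn // subset_leq_card.
(* The reindexing condition becomes [S :&: Q = Q], that is, [Q \subset S]; the other one says that
   [Q] avoids [A]. *)
- move=> Q; rewrite subsetDl andbT setDDr setDv set0U.
  rewrite !subsetD AS /= disjoint_sym.
  by rewrite andbC; congr (_ && _); apply/eqP/setIidPr.
rewrite (sum_subset_card _ (fun j => (-1) ^+ j)).
transitivity ((1 - 1) ^+ #|S :\: A| : rat).
  by rewrite exprDn; apply: eq_bigr => j _; rewrite expr1n mul1r.
by rewrite subrr expr0n cards_eq0 setD_eq0 eqEsubset AS.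
Qed.

(** Möbius inversion over the subsets of [S]: the condition [attained g = S] is replaced by a signed
    sum over [B], and after exchanging the sums each [B] is counted by [card_attained_sub]. *)
Lemma card_attained_eq (S : {set T}) :
  #|[set g | attained g == S]|%:R = (#|S|`!)%:R * istirling #|N| #|S|.
Proof.
rewrite /istirling mulrA divff ?mul1r; last first.
  by rewrite pnatr_eq0 -lt0n fact_gt0.
transitivity (\sum_(B : {set T} | B \subset S)
                (-1) ^+ (#|S| - #|B|) * (#|B|.+1)%:R ^+ #|N| : rat); last first.
  rewrite (sum_subset_card S (fun j => (-1) ^+ (#|S| - j) * (j.+1)%:R ^+ #|N|)).
  by apply: eq_bigr => j _; rewrite -[LHS]mulr_natr mulrAC.
transitivity (\sum_g \sum_(B : {set T} | (attained g \subset B) && (B \subset S))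
                (-1) ^+ (#|S| - #|B|) : rat).
  under eq_bigr do rewrite sum_sign_interval.
  rewrite -natr_sum -big_mkcond /= sum1_card.
  by congr (_ %:R); apply: eq_card => g; rewrite inE.
rewrite (exchange_big_dep (fun B : {set T} => B \subset S)) /=; last first.
  by move=> g B _ /andP [].
apply: eq_bigr => B BS; rewrite -natrX -card_attained_sub mulr_natr -sumr_const.
by apply: eq_bigl => g; rewrite inE BS andbT.
Qed.

End AttainedValues.

Lemma card_labels_le k : 0 < k -> #|{: labels k}| <= 2 ^ k - 2.
Proof.
move=> k_gt0; rewrite card_sig.
set E := [tuple of nseq k sym_e]; set C := [tuple of nseq k sym_c].
have EC : E != C.
  apply/eqP => /(congr1 (fun t : k.-tuple bool => tnth t (Ordinal k_gt0))).
  by rewrite !(tnth_nth false) !nth_nseq k_gt0.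
have := cardC [set E; C]; rewrite cards2 EC card_tuple card_bool => <-.
rewrite addKn; apply/subset_leq_card/subsetP => t.
by rewrite !inE negb_or.
Qed.

Section CoverOfMap.

Variables (N : finType) (k : nat).
Implicit Types (g : {ffun N -> option (labels k)}) (A : k.-tuple {set N}).

Definition cover_of_map g : k.-tuple {set N} :=
  [tuple [set a | if g a is Some t then tnth (val t) i else true] | i < k].

(** [insub] yields [None] on both constant tuples, so this inverts [cover_of_map] only on families
    that cover [N]. *)
Definition map_of_cover A : {ffun N -> option (labels k)} :=
  [ffun a => insub [tuple a \in tnth A i | i < k]].

Lemma in_cover_of_map g i a :
  (a \in tnth (cover_of_map g) i) =
    (if g a is Some t then tnth (val t) i else true).
Proof. by rewrite tnth_mktuple inE. Qed.

Lemma cover_of_mapK : cancel cover_of_map map_of_cover.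
Proof.
move=> g; apply/ffunP => a; rewrite ffunE.
case ga: (g a) => [t|].
  have -> : [tuple a \in tnth (cover_of_map g) i | i < k] = val t.
    by apply: eq_from_tnth => i; rewrite tnth_mktuple in_cover_of_map ga.
  exact: valK.
rewrite insubN // negb_and !negbK; apply/orP; right; apply/eqP.
apply: eq_from_tnth => i.
by rewrite tnth_mktuple in_cover_of_map ga (tnth_nth false) nth_nseq ltn_ord.
Qed.

Lemma map_of_coverK A :
  \bigcup_(i < k) tnth A i = [set: N] -> cover_of_map (map_of_cover A) = A.
Proof.
move=> covA; apply: eq_from_tnth => i; apply/setP => a.
rewrite in_cover_of_map ffunE; case: insubP => [t _ ->|].
  by rewrite tnth_mktuple.
rewrite negb_and !negbK.
(* An all-[e] tuple would leave [a] uncovered; an all-[c] tuple puts [a] in every set, as [None]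
   does. *)
case/orP => /eqP/(congr1 (fun t : k.-tuple bool => tnth t)) At.
  have : a \in \bigcup_(i < k) tnth A i by rewrite covA.
  case/bigcupP => j _; have := congr1 (fun f => f j) At.
  by rewrite tnth_mktuple (tnth_nth false) nth_nseq ltn_ord => ->.
have := congr1 (fun f => f i) At.
by rewrite tnth_mktuple (tnth_nth false) nth_nseq ltn_ord => ->.
Qed.

Lemma bigcup_cover_of_map g :
  0 < k -> \bigcup_(i < k) tnth (cover_of_map g) i = [set: N].
Proof.
move=> k_gt0; apply/setP => a; rewrite inE; apply/bigcupP.
case ga: (g a) => [t|]; last first.
  by exists (Ordinal k_gt0) => //; rewrite in_cover_of_map ga.
case: (pickP (fun i => tnth (val t) i)) => [i ti|t0].
  by exists i => //; rewrite in_cover_of_map ga.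
have /andP [/eqP[]] := valP t; apply: eq_from_tnth => i.
by rewrite t0 (tnth_nth false) nth_nseq ltn_ord.
Qed.

Definition labeling_of_map g : {ffun labels k -> bool} :=
  [ffun t => t \in attained g].

Lemma weight_labeling_of_map g :
  \sum_(t : labels k) labeling_of_map g t = #|attained g|.
Proof.
rewrite -sum1_card [RHS]big_mkcond /=.
by apply: eq_bigr => t _; rewrite ffunE; case: (_ \in _).
Qed.

(** A point lies in [A_i] but not in [A_j] exactly when its value is some label [t] with [t_i = c]
    and [t_j = e]; the value [None] never separates two sets. *)
Lemma constructive_cover_of_map g : 0 < k ->
  (cover_of_map g \in constructive_covers N k) = (labeling_of_map g \in labelings k).
Proof.
move=> k_gt0; rewrite !inE /constructive_cover bigcup_cover_of_map // eqxx /=.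
have sepE i j : (tnth (cover_of_map g) i :\: tnth (cover_of_map g) j != set0) =
  (1 <= \sum_(t : labels k | (tnth (val t) i == sym_c) &&
                             (tnth (val t) j == sym_e)) labeling_of_map g t).
  rewrite lt0n sum_nat_eq0 negb_forall; apply/set0Pn/existsP.
    case=> a; rewrite inE !in_cover_of_map; case ga: (g a) => [t|] //.
    case/andP => tj ti; exists t; rewrite ti (negPf tj) /= ffunE inE.
    by rewrite -ga codom_f.
  case=> t; rewrite negb_imply => /andP [/andP [/eqP ti /eqP tj]].
  rewrite ffunE inE eqb0 negbK => /codomP [a ga].
  by exists a; rewrite inE !in_cover_of_map -ga ti tj.
rewrite (eq_forallb (fun i => eq_forallb (fun j => congr1 (implb _) (sepE i j)))).
(* Distinctness follows from separation: equal sets have an empty difference. *)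
apply: andb_idl => /forallP sep; apply/(tuple_uniqP (cover_of_map g)) => i j eqA.
apply/eqP; apply: contraT => ij; have := implyP (forallP (sep i) j) ij.
by rewrite -sepE eqA setDv eqxx.
Qed.

Lemma card_constructive_covers : 0 < k ->
  #|constructive_covers N k| = #|[set g | labeling_of_map g \in labelings k]|.
Proof.
move=> k_gt0; rewrite -(card_imset _ (can_inj cover_of_mapK)).
congr #|pred_of_set _|; apply/setP => A; apply/idP/imsetP => [covA|[g]]; last first.
  by rewrite [_ \in [set _ | _]]inE => gG ->; rewrite constructive_cover_of_map.
have AK : cover_of_map (map_of_cover A) = A.
  by apply: map_of_coverK; move: covA; rewrite inE => /and3P [_ /eqP].
by exists (map_of_cover A); rewrite // inE -constructive_cover_of_map // AK.
Qed.

(** The constraint for the indices 0 and 1, available since [1 < k], already forces a label of value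
    1. *)
Lemma labelings_weight_gt0 (x : {ffun labels k -> bool}) :
  1 < k -> x \in labelings k -> 0 < \sum_(t : labels k) x t.
Proof.
move=> k_gt1; rewrite inE => /forallP /(_ (Ordinal (ltnW k_gt1))).
move=> /forallP /(_ (Ordinal k_gt1)) /= /leq_trans; apply.
by rewrite [leqLHS]big_mkcond; apply: leq_sum => t _; case: ifP.
Qed.

Local Open Scope ring_scope.

(** The fibre over a labeling [x] consists of the maps attaining exactly the support of [x]; its
    size depends only on [l]. *)
Lemma card_maps_of_weight l :
  #|[set g | labeling_of_map g \in labelings_of_weight k l]|%:R =
    (l`!)%:R * istirling #|N| l * #|labelings_of_weight k l|%:R.
Proof.
rewrite -sum1_card.
rewrite (partition_big labeling_of_map (mem (labelings_of_weight k l))) /=;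
  last by move=> g; rewrite inE.
rewrite natr_sum mulr_natr -sumr_const; apply: eq_bigr => x xF.
set S := [set t | x t].
have labE g : (labeling_of_map g == x) = (attained g == S).
  apply/eqP/eqP => [gx|gS]; first by apply/setP => t; rewrite [RHS]inE -gx ffunE.
  by apply/ffunP => t; rewrite ffunE gS inE.
have cardS : #|S| = l.
  move: xF; rewrite inE => /andP [_ /eqP <-]; rewrite -sum1_card big_mkcond /=.
  by apply: eq_bigr => t _; rewrite inE; case: (x t).
rewrite -[in RHS]cardS -card_attained_eq sum1_card; congr (_%:R).
apply: eq_card => g; rewrite [in RHS]inE -labE unfold_in /= inE.
by apply: andb_idl => /eqP ->.
Qed.

End CoverOfMap.

(* The case k = 1 is excluded because the identity is false there: the only
   cover is the full set, while the sum, over 1 <= l <= 0, is empty. *)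
Theorem corollary3p6 (N : finType) (n k : nat)
    (card_N : #|N| = n) (n_gt0 : 0 < n) (k_range : 1 < k <= n) :
  (#|constructive_covers N k|%:R =
   \sum_(1 <= l < (minn (2 ^ k - 2) n).+1)
      (l`!)%:R * istirling n l * #|labelings_of_weight k l|%:R :> rat)%R.
Proof.
have /andP [k_gt1 _] := k_range; have k_gt0 := ltnW k_gt1.
rewrite -card_N card_constructive_covers //.
under eq_bigr do rewrite -card_maps_of_weight.
rewrite -natr_sum; congr (_%:R)%R.
(* Exchanging the sums, each admissible map is counted once, at [l = #|attained g|], which the
   bounds below place within the range of summation. *)
under eq_bigr do rewrite -sum1_card big_mkcond /=.
rewrite exchange_big /= -[LHS]sum1_card [LHS]big_mkcond /=.
apply: eq_bigr => g _.
rewrite inE; under eq_bigr do rewrite !inE weight_labeling_of_map.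
case: ifP => gG; last first.
  by rewrite big1 // => l _; move: gG; rewrite inE => ->.
have w_gt0 : 0 < #|attained g|.
  by rewrite -weight_labeling_of_map labelings_weight_gt0.
have w_le : #|attained g| <= minn (2 ^ k - 2) #|N|.
  by rewrite leq_min card_attained_le (leq_trans (max_card _) (card_labels_le _)).
move: gG; rewrite inE => ->; rewrite -big_mkcond /=.
under eq_bigl do rewrite eq_sym.
by rewrite big_nat1_eq w_gt0 ltnS w_le.
Qed.
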